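(* Let $(\mathcal{A},[\cdot,\cdot],N)$ be a Nijenhuis mock-Lie algebra, $V$ a finite-dimensional vector space, $(V,\rho)$ a representation of $(\mathcal{A},[\cdot,\cdot])$, $\beta:V\to V$ a linear map such that $(V^*,\rho^*,\beta^* )$ is a representation of $(\mathcal{A},[\cdot,\cdot],N)$, and let $S:\mathcal{A}\to\mathcal{A}$, $\alpha:V\to V$, $T:V\to\mathcal{A}$ be linear maps. Identify $T$ with an element of $\mathcal{A}\otimes V^*\subseteq(\mathcal{A}\ltimes_{\rho^*}V^* )\otimes(\mathcal{A}\ltimes_{\rho^*}V^* )$ via $\mathrm{Hom}(V,\mathcal{A})\cong\mathcal{A}\otimes V^*$. (1) $r=T-\tau(T)$ is an antisymmetric solution of the $(S+\alpha^* )$-admissible mock-Lie-Yang-Baxter equation in the Nijenhuis mock-Lie algebra $(\mathcal{A}\ltimes_{\rho^*}V^*,N+\beta^* )$ if and only if $T$ is a weak $O$-operator associated to $(V,\rho)$ and $\alpha$, and $T\circ\beta=S\circ T$. (2) Assume that $(V,\rho,\alpha)$ is a representation of $(\mathcal{A},[\cdot,\cdot],N)$. If $T$ is an $O$-operator associated to $(V,\rho,\alpha)$ and $T\circ\beta=S\circ T$, then $r=T-\tau(T)$ is an antisymmetric solution of the $(S+\alpha^* )$-admissible mock-Lie-Yang-Baxter equation in the Nijenhuis mock-Lie algebra $(\mathcal{A}\ltimes_{\rho^*}V^*,N+\beta^* )$. If in addition $(\mathcal{A},[\cdot,\cdot],N)$ is $S$-adjoint-admissible and $$\beta(\rho(y)\alpha(u))+\rho(S^2(y))u=\rho(S(y))\alpha(u)+\beta(\rho(S(y))u)\quad\text{for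 all }y\in\mathcal{A},\ u\in V$$ (so that the Nijenhuis mock-Lie algebra $(\mathcal{A}\ltimes_{\rho^*}V^*,N+\beta^* )$ is $(S+\alpha^* )$-adjoint-admissible), then $(\mathcal{A}\ltimes_{\rho^*}V^*,N+\beta^*,\Delta_r,S+\alpha^* )$ is a Nijenhuis mock-Lie bialgebra, where, writing $r=\sum_ic_i\otimes d_i$, $\Delta_r(z)=\sum_i[z,c_i]\otimes d_i-c_i\otimes[z,d_i]$ for $z\in\mathcal{A}\ltimes_{\rho^*}V^*$.
   Context: All vector spaces are over a field $K$ of characteristic zero; $\tau$ is the flip; $f^*$ denotes the transpose of $f$; $f+g$ on a direct sum means $(f+g)(x+u)=f(x)+g(u)$. A mock-Lie algebra is a vector space with a commutative bilinear map $[\cdot,\cdot]$ such that $[x,[y,z]]+[y,[z,x]]+[z,[x,y]]=0$. A Nijenhuis mock-Lie algebra $(\mathcal{A},[\cdot,\cdot],N)$ is a mock-Lie algebra with a linear map $N$ such that $[N(x),N(y)]+N^2([x,y])=N([N(x),y])+N([x,N(y)])$. For a linear map $S:\mathcal{A}\to\mathcal{A}$, it is $S$-adjoint-admissible if $S([N(x),y])+[x,S^2(y)]=[N(x),S(y)]+S([x,S(y)])$ for all $x,y$. $(V,\rho)$ is a representation of $(\mathcal{A},[\cdot,\cdot])$ if $\rho:\mathcal{A}\to\mathrm{End}(V)$ is linear with $\rho([x,y])v=-\rho(x)(\rho(y)v)-\rho(y)(\rho(x)v)$; $(V,\rho,\alpha)$ is a representation of $(\mathcal{A},[\cdot,\cdot],N)$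 if moreover $\alpha\in\mathrm{End}(V)$ satisfies $\rho(N(x))\alpha(v)+\alpha^2(\rho(x)v)=\alpha(\rho(N(x))v)+\alpha(\rho(x)\alpha(v))$. The dual representation is $\langle\rho^*(x)u^*,v\rangle=\langle u^*,\rho(x)v\rangle$. The semidirect product $\mathcal{A}\ltimes_\rho V$ is $\mathcal{A}\oplus V$ with $[x+u,y+v]_\star=[x,y]+\rho(x)v+\rho(y)u$; if $(V,\rho,\alpha)$ is a representation of $(\mathcal{A},[\cdot,\cdot],N)$, then $(\mathcal{A}\ltimes_\rho V,N+\alpha)$ is a Nijenhuis mock-Lie algebra. A linear map $T:V\to\mathcal{A}$ is a weak $O$-operator associated to $(V,\rho)$ and $\alpha$ if $[T(u),T(v)]=T(\rho(T(u))v+\rho(T(v))u)$ for all $u,v\in V$ and $N\circ T=T\circ\alpha$. If $(V,\rho,\alpha)$ is a representation of $(\mathcal{A},[\cdot,\cdot],N)$, such a $T$ is called an $O$-operator associated to $(V,\rho,\alpha)$. For a Nijenhuis mock-Lie algebra $(\mathcal{G},[\cdot,\cdot],M)$, a linear map $Q:\mathcal{G}\to\mathcal{G}$ and $r=\sum_ic_i\otimes d_i\in\mathcal{G}\otimes\mathcal{G}$, the $Q$-admissible mock-Lie-Yang-Baxter equation is the system $\sum_{i,j}([c_i,c_j]\otimes d_i\otimes d_j+c_i\otimes c_j\otimes[d_i,d_j]-c_i\otimes[d_i,c_j]\otimes d_j)=0$, $(M\otimes\mathrm{id}-\mathrm{id}\otimes Q)(r)=0$, $(Q\otimes\mathrm{id}-\mathrm{id}\otimes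 M)(r)=0$. Antisymmetric means $r=-\tau(r)$. A mock-Lie coalgebra $(\mathcal{G},\Delta)$, $\Delta(x)=x_{(1)}\otimes x_{(2)}$, satisfies $x_{(1)}\otimes x_{(2)}=x_{(2)}\otimes x_{(1)}$ and $x_{(1)}\otimes x_{(2)(1)}\otimes x_{(2)(2)}+x_{(1)(1)}\otimes x_{(1)(2)}\otimes x_{(2)}+x_{(2)(1)}\otimes x_{(1)}\otimes x_{(2)(2)}=0$. A mock-Lie bialgebra is a mock-Lie algebra and mock-Lie coalgebra with $\Delta([x,y])=-[x,y_{(1)}]\otimes y_{(2)}-y_{(1)}\otimes[x,y_{(2)}]-[y,x_{(1)}]\otimes x_{(2)}-x_{(1)}\otimes[y,x_{(2)}]$. A Nijenhuis mock-Lie bialgebra $(\mathcal{G},M,\Delta,Q)$ (bracket understood) consists of a mock-Lie bialgebra $(\mathcal{G},[\cdot,\cdot],\Delta)$ such that $(\mathcal{G},[\cdot,\cdot],M)$ is a $Q$-adjoint-admissible Nijenhuis mock-Lie algebra, $(Q\otimes Q)\Delta+\Delta Q^2=(Q\otimes\mathrm{id})\Delta Q+(\mathrm{id}\otimes Q)\Delta Q$, and $(Q\otimes\mathrm{id})\Delta M+(\mathrm{id}\otimes M^2)\Delta=(Q\otimes M)\Delta+(\mathrm{id}\otimes M)\Delta M$. *)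

(* Defs.v *)
From HB Require Import structures.
From mathcomp Require Import all_boot all_algebra.
From mathcomp Require Import boolp.

Set Implicit Arguments.
Unset Strict Implicit.
Unset Printing Implicit Defensive.

Import GRing.Theory.
Local Open Scope ring_scope.
Local Open Scope quotient_scope.

Definition bilinear_map (K : fieldType) (U V W : lmodType K)
    (f : U -> V -> W) : Prop :=
  (forall x, linear (f x)) /\ (forall y, linear (f^~ y)).

Lemma bilinear_map0l (K : fieldType) (U V W : lmodType K) (f : U -> V -> W) :
  bilinear_map f -> forall y, f 0 y = 0.
Proof.
case=> _ fl y; have := fl y 1 0 0; rewrite !scale1r addr0 => /eqP.
by rewrite eq_sym -subr_eq0 addrK => /eqP.
Qed.

Lemma bilinear_map0r (K : fieldType) (U V W : lmodType K) (f : U -> V -> W) :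
  bilinear_map f -> forall x, f x 0 = 0.
Proof.
case=> fr _ x; have := fr x 1 0 0; rewrite !scale1r addr0 => /eqP.
by rewrite eq_sym -subr_eq0 addrK => /eqP.
Qed.

(* Tensor products of arbitrary (possibly infinite-dimensional) spaces, which
   the libraries do not provide: formal sums of pairs modulo the congruence
   generated by the bilinearity relations. A multiple k (x, y) of a pair is
   encoded by (k x, y). *)

Section TensorCongruence.
Variables (K : fieldType) (A B : lmodType K).

Inductive tens_cong : seq (A * B) -> seq (A * B) -> Prop :=
| tc_refl s : tens_cong s s
| tc_sym s t : tens_cong s t -> tens_cong t s
| tc_trans s t u : tens_cong s t -> tens_cong t u -> tens_cong s u
| tc_cat s s' t t' :
    tens_cong s s' -> tens_cong t t' -> tens_cong (s ++ t) (s' ++ t')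
| tc_comm s t : tens_cong (s ++ t) (t ++ s)
| tc_zero y : tens_cong [:: (0, y)] [::]
| tc_addl x x' y : tens_cong [:: (x + x', y)] [:: (x, y); (x', y)]
| tc_addr x y y' : tens_cong [:: (x, y + y')] [:: (x, y); (x, y')]
| tc_scale k x y : tens_cong [:: (k *: x, y)] [:: (x, k *: y)].

Definition tens_rel (s t : seq (A * B)) : bool := `[< tens_cong s t >].

Lemma tens_rel_refl : reflexive tens_rel.
Proof. by move=> s; apply/asboolP/tc_refl. Qed.

Lemma tens_rel_sym : symmetric tens_rel.
Proof. by move=> s t; apply/asboolP/asboolP; apply: tc_sym. Qed.

Lemma tens_rel_trans : transitive tens_rel.
Proof.
by move=> t s u /asboolP st /asboolP tu; apply/asboolP; apply: tc_trans tu.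
Qed.

Canonical tens_equiv := EquivRel tens_rel tens_rel_refl tens_rel_sym tens_rel_trans.

Definition tensor := {eq_quot tens_rel}.

HB.instance Definition _ : EqQuotient _ tens_rel tensor := EqQuotient.on tensor.
HB.instance Definition _ := Choice.on tensor.

Definition tpi (s : seq (A * B)) : tensor := \pi_tensor s.

Lemma tpiE s t : tens_cong s t <-> tpi s = tpi t.
Proof.
by split=> [st|/eqmodP /asboolP//]; apply/eqmodP/asboolP.
Qed.

Lemma tpiK t : tpi (repr t) = t.
Proof. exact: reprK. Qed.

Lemma repr_tpi s : tens_cong (repr (tpi s)) s.
Proof. by apply/tpiE; rewrite tpiK. Qed.

Definition tadd (s t : tensor) : tensor := tpi (repr s ++ repr t).

Definition tscale (k : K) (t : tensor) : tensor :=
  tpi [seq (k *: p.1, p.2) | p <- repr t].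

Definition topp (t : tensor) : tensor := tscale (- 1) t.

Lemma taddE s t : tadd (tpi s) (tpi t) = tpi (s ++ t).
Proof. by apply/tpiE; apply: tc_cat; apply: repr_tpi. Qed.

Lemma tens_cong_scale k s t : tens_cong s t ->
  tens_cong [seq (k *: p.1, p.2) | p <- s] [seq (k *: p.1, p.2) | p <- t].
Proof.
elim=> /= [u|u v _ /tc_sym//|u v w _ uv _|u u' v v' _ uu _ vv|u v|y|x x' y|x y y'|l x y].
- exact: tc_refl.
- exact: tc_trans uv.
- by rewrite !map_cat; apply: tc_cat.
- by rewrite !map_cat; apply: tc_comm.
- by rewrite scaler0; apply: tc_zero.
- by rewrite scalerDr; apply: tc_addl.
- exact: tc_addr.
- by rewrite scalerA mulrC -scalerA; apply: tc_scale.
Qed.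

Lemma tscaleE k s : tscale k (tpi s) = tpi [seq (k *: p.1, p.2) | p <- s].
Proof. by apply/tpiE; apply: tens_cong_scale; apply: repr_tpi. Qed.

Lemma taddA : associative tadd.
Proof.
move=> s t u; rewrite -[s]tpiK -[t]tpiK -[u]tpiK.
by rewrite !taddE catA.
Qed.

Lemma taddC : commutative tadd.
Proof. by move=> s t; apply/tpiE; apply: tc_comm. Qed.

Lemma tadd0 : left_id (tpi [::]) tadd.
Proof. by move=> s; rewrite -[s]tpiK taddE. Qed.

Lemma tens_cong_cons p q s t : tens_cong [:: p] q -> tens_cong s t ->
  tens_cong (p :: s) (q ++ t).
Proof. by move=> pq st; rewrite -cat1s; apply: tc_cat. Qed.

Lemma tens_cong_shuffle p q s t :
  tens_cong (p :: q :: s ++ t) (p :: s ++ q :: t).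
Proof.
apply: (@tc_cat [:: p] [:: p]); first exact: tc_refl.
by have := tc_cat (tc_comm [:: q] s) (tc_refl t); rewrite -!catA.
Qed.

Lemma tscaleDl k l t : tscale (k + l) t = tadd (tscale k t) (tscale l t).
Proof.
rewrite -[t]tpiK !tscaleE taddE; apply/tpiE.
elim: (repr t) => [|p s IHs] /=; first exact: tc_refl.
rewrite scalerDl.
apply: tc_trans (tens_cong_cons (tc_addl _ _ _) IHs) _ => /=.
exact: tens_cong_shuffle.
Qed.

Lemma tscale0 t : tscale 0 t = tpi [::].
Proof.
rewrite -[t]tpiK tscaleE; apply/tpiE.
elim: (repr t) => [|p s IHs] /=; first exact: tc_refl.
by rewrite scale0r; apply: (tens_cong_cons (tc_zero _) IHs).
Qed.

Lemma tscale1 t : tscale 1 t = t.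
Proof.
rewrite -[t]tpiK tscaleE; congr tpi.
by rewrite -[RHS]map_id; apply: eq_map => -[x y] /=; rewrite scale1r.
Qed.

Lemma taddN : left_inverse (tpi [::]) topp tadd.
Proof. by move=> t; rewrite -{2}[t]tscale1 -tscaleDl addNr tscale0. Qed.

HB.instance Definition _ := GRing.isZmodule.Build tensor taddA taddC tadd0 taddN.

Lemma tscaleA k l t : tscale k (tscale l t) = tscale (k * l) t.
Proof.
rewrite -[t]tpiK !tscaleE -map_comp; congr tpi.
by apply: eq_map => -[x y] /=; rewrite scalerA.
Qed.

Lemma tscaleDr : right_distributive tscale +%R.
Proof.
move=> k s t; rewrite -[s]tpiK -[t]tpiK.
by rewrite [_ + _]taddE !tscaleE map_cat -taddE.
Qed.

HB.instance Definition _ := GRing.Zmodule_isLmodule.Build K tensor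
  tscaleA tscale1 tscaleDr (fun t k l => tscaleDl k l t).

Lemma tpiD s t : tpi s + tpi t = tpi (s ++ t).
Proof. exact: taddE. Qed.

Lemma tpiZ k s : k *: tpi s = tpi [seq (k *: p.1, p.2) | p <- s].
Proof. exact: tscaleE. Qed.

Definition tens (x : A) (y : B) : tensor := tpi [:: (x, y)].

End TensorCongruence.

Arguments tensor {K} (A B)%_type_scope.
Notation "x ⊗ y" := (tens x y) (at level 35, right associativity) : ring_scope.
Notation "A ⊗ B" := (tensor A B) : type_scope.

(* [tlift f t] is the sum of the f c_i d_i where the sum of the c_i ⊗ d_i is
   some chosen representative of t. For bilinear f it does not depend on this
   choice and is the linear map induced by f (lemmas tlift_tens, tlift_linear,
   tlift_sum below); for a coproduct it renders Sweedler's notation: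
   f x_(1) x_(2) is [tlift f (Delta x)]. *)
Definition tlift (K : fieldType) (A B W : lmodType K) (f : A -> B -> W)
    (t : A ⊗ B) : W :=
  \sum_(p <- repr t) f p.1 p.2.

Definition tmap (K : fieldType) (A B A' B' : lmodType K)
    (f : A -> A') (g : B -> B') : A ⊗ B -> A' ⊗ B' :=
  tlift (fun x y => f x ⊗ g y).

Definition tflip (K : fieldType) (A B : lmodType K) : A ⊗ B -> B ⊗ A :=
  tlift (fun x y => y ⊗ x).

Section TensorTheory.
Variables (K : fieldType).
Implicit Types (A B W : lmodType K).

Lemma tens_bilinear A B : bilinear_map (@tens K A B).
Proof.
split=> [x k y y'|y k x x'].
  rewrite /tens tpiZ tpiD; apply/tpiE; apply: tc_trans (tc_addr _ _ _) _.
  by apply: (@tc_cat _ _ _ [:: _] [:: _] [:: _] [:: _]);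
    [apply: tc_sym; apply: tc_scale | apply: tc_refl].
by rewrite /tens tpiZ tpiD; apply/tpiE; apply: tc_addl.
Qed.

Lemma tpi_sum A B (s : seq (A * B)) : tpi s = \sum_(p <- s) p.1 ⊗ p.2.
Proof.
elim: s => [|[x y] s IHs]; first by rewrite big_nil.
by rewrite big_cons -IHs /tens tpiD.
Qed.

Lemma tensorP A B (t : A ⊗ B) :
  exists s : seq (A * B), t = \sum_(p <- s) p.1 ⊗ p.2.
Proof. by exists (repr t); rewrite -tpi_sum tpiK. Qed.

Lemma tens_cong_lift A B W (f : A -> B -> W) : bilinear_map f ->
  forall s t, tens_cong s t ->
    \sum_(p <- s) f p.1 p.2 = \sum_(p <- t) f p.1 p.2.
Proof.
move=> fB; have [fr fl] := fB; have f0 := bilinear_map0l fB.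
have f0r := bilinear_map0r fB.
move=> s t; elim=> //= [u v w _ -> _ -> //|u u' v v' _ uu _ vv|u v|y|x x' y|x y y'|l x y];
  rewrite ?big_cat ?big_cons ?big_nil ?addr0 //=.
- by rewrite uu vv.
- by rewrite addrC.
- by have := fl y 1 x x'; rewrite !scale1r.
- by have := fr x 1 y y'; rewrite !scale1r.
- by have := fl y l x 0; have := fr x l y 0; rewrite !addr0 f0 f0r !addr0 => -> ->.
Qed.

Section Lift.
Variables (A B W : lmodType K) (f : A -> B -> W).
Hypothesis fB : bilinear_map f.

Lemma tlift_sum (s : seq (A * B)) :
  tlift f (\sum_(p <- s) p.1 ⊗ p.2) = \sum_(p <- s) f p.1 p.2.
Proof. by rewrite -tpi_sum; apply: tens_cong_lift (repr_tpi s). Qed.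

Lemma tlift_tens x y : tlift f (x ⊗ y) = f x y.
Proof. by have := tlift_sum [:: (x, y)]; rewrite !big_seq1. Qed.

Lemma tlift_linear : linear (tlift f).
Proof.
move=> k s t; have [u ->] := tensorP s; have [v ->] := tensorP t.
rewrite !tlift_sum -!tpi_sum tpiZ tpiD tpi_sum tlift_sum.
rewrite big_cat big_map /= scaler_sumr; congr (_ + _).
apply: eq_bigr => p _; have [fr fl] := fB.
by have := fl p.2 k p.1 0; rewrite !addr0 (bilinear_map0l fB) addr0.
Qed.

Lemma tlift_bigsum I (r : seq I) (P : pred I) (F : I -> A ⊗ B) :
  tlift f (\sum_(i <- r | P i) F i) = \sum_(i <- r | P i) tlift f (F i).
Proof.
pose gm := GRing.isLinear.Build K (A ⊗ B)%type W *:%R _ tlift_linear.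
pose gl : {linear (A ⊗ B)%type -> W} := HB.pack (tlift f) gm.
exact: (linear_sum gl).
Qed.

Lemma tlift_unique (g : A ⊗ B -> W) :
  linear g -> (forall x y, g (x ⊗ y) = f x y) -> g =1 tlift f.
Proof.
move=> gL gf t; have [s ->] := tensorP t.
pose gm := GRing.isLinear.Build K (A ⊗ B)%type W *:%R g gL.
pose gl : {linear (A ⊗ B)%type -> W} := HB.pack g gm.
by rewrite tlift_sum -[g _]/(gl _) linear_sum; apply: eq_bigr => p _; apply: gf.
Qed.

End Lift.

Lemma tmap_tens A B A' B' (f : {linear A -> A'}) (g : {linear B -> B'}) x y :
  tmap f g (x ⊗ y) = f x ⊗ g y.
Proof.
apply: tlift_tens (x) (y); have [tr tl] := @tens_bilinear A' B'.
by split=> [u k v w|v k u w] /=; rewrite linearP; [apply: tr | apply: tl].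
Qed.

Lemma tflip_tens A B (x : A) (y : B) : tflip (x ⊗ y) = y ⊗ x.
Proof. by apply: tlift_tens; have [] := @tens_bilinear B A. Qed.

End TensorTheory.

Section MockLie.
Variables (K : fieldType) (A : lmodType K).

Record mock_lie (br : A -> A -> A) : Prop := {
  ml_bilinear : bilinear_map br;
  ml_comm : forall x y, br x y = br y x;
  ml_jacobi : forall x y z, br x (br y z) + br y (br z x) + br z (br x y) = 0
}.

Record nijenhuis_mock_lie (br : A -> A -> A) (N : A -> A) : Prop := {
  nml_mock_lie : mock_lie br;
  nml_linear : linear N;
  nml_nijenhuis : forall x y,
    br (N x) (N y) + N (N (br x y)) = N (br (N x) y) + N (br x (N y))
}.

Definition adjoint_admissible (br : A -> A -> A) (N S : A -> A) : Prop :=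
  forall x y, S (br (N x) y) + br x (S (S y)) = br (N x) (S y) + S (br x (S y)).

Record ml_rep (V : vectType K) (br : A -> A -> A) (rho : A -> 'End(V)) : Prop := {
  mlr_linear : linear rho;
  mlr_bracket : forall x y v,
    rho (br x y) v = - rho x (rho y v) - rho y (rho x v)
}.

Record nml_rep (V : vectType K) (br : A -> A -> A) (N : A -> A)
    (rho : A -> 'End(V)) (alpha : 'End(V)) : Prop := {
  nmlr_rep : ml_rep br rho;
  nmlr_nijenhuis : forall x v,
    rho (N x) (alpha v) + alpha (alpha (rho x v)) =
    alpha (rho (N x) v) + alpha (rho x (alpha v))
}.

Definition weak_O_operator (V : vectType K) (br : A -> A -> A) (N : A -> A)
    (rho : A -> 'End(V)) (alpha : 'End(V)) (T : V -> A) : Prop :=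
  (forall u v, br (T u) (T v) = T (rho (T u) v + rho (T v) u)) /\
  (forall v, N (T v) = T (alpha v)).

Definition O_operator (V : vectType K) (br : A -> A -> A) (N : A -> A)
    (rho : A -> 'End(V)) (alpha : 'End(V)) (T : V -> A) : Prop :=
  nml_rep br N rho alpha /\ weak_O_operator br N rho alpha T.

Definition semidirect (V : vectType K) (br : A -> A -> A) (rho : A -> 'End(V))
    (z w : A * V) : A * V :=
  (br z.1 w.1, rho z.1 w.2 + rho w.1 z.2).

Definition sum_op (V : vectType K) (f : A -> A) (g : 'End(V)) (z : A * V) : A * V :=
  (f z.1, g z.2).

End MockLie.

Lemma semidirect_nijenhuis (K : fieldType) (A : lmodType K) (V : vectType K)
    (br : A -> A -> A) (N : A -> A)
    (rho : A -> 'End(V)) (alpha : 'End(V)) :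
  nijenhuis_mock_lie br N -> nml_rep br N rho alpha ->
  nijenhuis_mock_lie (semidirect br rho) (sum_op N alpha).
Proof.
case=> -[[brr brl] brC brJ] NL NN [[rL rB] rN].
have rLE k x y v : rho (k *: x + y) v = k *: rho x v + rho y v.
  by rewrite rL add_lfunE scale_lfunE.
split; first split; first split.
- move=> [x u] k [y v] [z w]; rewrite /semidirect /=; congr (_, _); first exact: brr.
  by rewrite linearP rLE -[RHS]/(k *: (_ + _) + (_ + _)) scalerDr addrACA.
- move=> [x u] k [y v] [z w]; rewrite /semidirect /=; congr (_, _); first exact: brl.
  by rewrite linearP rLE -[RHS]/(k *: (_ + _) + (_ + _)) scalerDr addrACA.
- by move=> [x u] [y v]; rewrite /semidirect /= brC addrC.
- move=> [x u] [y v] [z w]; rewrite /semidirect /=; congr (_, _); first exact: brJ.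
  rewrite !rB !linearD /=.
  rewrite (AC ((2*2)*(2*2)*(2*2)) ((1*11)*(2*8)*(5*3)*(10*4)*(6*12)*(9*7))) /=.
  by rewrite !subrr !addr0.
- by move=> k [x u] [y v]; rewrite /sum_op /=; congr (_, _); [apply: NL | rewrite linearP].
- move=> [x u] [y v]; rewrite /semidirect /sum_op /=; congr (_, _); first exact: NN.
  rewrite !linearD /= addrACA rN [in RHS]addrACA -[in RHS]addrA.
  have := rN y u; rewrite [alpha (rho (N y) u) + _]addrC => rNy.
  by rewrite rNy [in RHS]addrA.
Qed.

Section Dual.
Variables (K : fieldType) (V : vectType K).

Definition dual : vectType K := 'Hom(V, K^o).

Definition transpose (f : 'End(V)) : 'End(dual) :=
  linfun (fun phi : dual => (phi \o f)%VF : dual).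

Lemma transposeE (f : 'End(V)) (phi : dual) v : transpose f phi v = phi (f v).
Proof.
have fL : linear (fun phi : dual => (phi \o f)%VF : dual).
  by move=> k x y; rewrite comp_lfunDl comp_lfunZl.
pose gm := GRing.isLinear.Build K dual dual *:%R _ fL.
pose gl : {linear dual -> dual} := HB.pack (fun phi : dual => (phi \o f)%VF : dual) gm.
by rewrite /transpose (lfunE gl) /= comp_lfunE.
Qed.

Definition dual_rep (A : lmodType K) (rho : A -> 'End(V)) (x : A) : 'End(dual) :=
  transpose (rho x).

Definition dual_vbasis (i : 'I_(\dim {:V})) : dual :=
  linfun (fun v : V => coord (vbasis {:V}) i v : K^o).

Lemma dual_vbasisE i v : dual_vbasis i v = coord (vbasis {:V}) i v.
Proof.
have fL : linear (fun v : V => coord (vbasis {:V}) i v : K^o).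
  by move=> k x y; rewrite linearP.
pose gm := GRing.isLinear.Build K V K^o *:%R _ fL.
pose gl : {linear V -> K^o} := HB.pack (fun v : V => coord (vbasis {:V}) i v : K^o) gm.
exact: (lfunE gl).
Qed.

(* The element of A ⊗ V^* that corresponds to T under the canonical isomorphism
   A ⊗ V^* -> Hom(V, A), a ⊗ phi |-> (v |-> phi(v) a); see hom_tensorP. *)
Definition hom_tensor (A : lmodType K) (T : V -> A) : A ⊗ dual :=
  \sum_(i < \dim {:V}) T (vbasis {:V})`_i ⊗ dual_vbasis i.

Lemma hom_tensorP (A : lmodType K) (T : {linear V -> A}) (t : A ⊗ dual) :
  (forall v, tlift (fun (a : A) (phi : dual) => (phi v : K) *: a) t = T v) <-> t = hom_tensor T.
Proof.
have evB v : bilinear_map (fun (a : A) (phi : dual) => (phi v : K) *: a).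
  split=> [a k phi psi|phi k a b].
    by rewrite add_lfunE scale_lfunE scalerDl -scalerA.
  by rewrite scalerDr !scalerA mulrC.
have vE v : v = \sum_i coord (vbasis {:V}) i v *: (vbasis {:V})`_i.
  exact/coord_vbasis/memvf.
have tB := @tens_bilinear K A dual; have [tr tl] := tB.
have t0l (phi : dual) : (0 : A) ⊗ phi = 0 by apply: (bilinear_map0l tB).
have t0r (a : A) : a ⊗ (0 : dual) = 0 by apply: (bilinear_map0r tB).
have tZ k (a : A) (phi : dual) : (k *: a) ⊗ phi = a ⊗ (k *: phi).
  have := tl phi k a 0; rewrite !addr0 t0l addr0 => ->.
  by have := tr a k phi 0; rewrite !addr0 t0r addr0 => ->.
have tSl (r : seq (A * dual)) (F : A * dual -> A) (phi : dual) :
    (\sum_(p <- r) F p) ⊗ phi = \sum_(p <- r) F p ⊗ phi.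
  elim: r => [|p r IH]; first by rewrite !big_nil t0l.
  by rewrite !big_cons -IH; have := tl phi 1 (F p); rewrite !scale1r => ->.
have tSr (a : A) (F : 'I_(\dim {:V}) -> dual) :
    a ⊗ (\sum_i F i) = \sum_i a ⊗ F i.
  apply: (big_morph (fun phi => a ⊗ phi)) => [phi psi|].
    by have := tr a 1 phi psi; rewrite !scale1r.
  exact: t0r.
split=> [tT|-> v]; last first.
  rewrite tlift_bigsum // [in RHS](vE v) linear_sum; apply: eq_bigr => i _.
  by rewrite tlift_tens // dual_vbasisE linearZ.
rewrite /hom_tensor; have [s st] := tensorP t.
transitivity (\sum_(i < \dim {:V}) (\sum_(p <- s) (p.2 (vbasis {:V})`_i : K) *: p.1) ⊗ dual_vbasis i);
  last by apply: eq_bigr => i _; rewrite -tT st tlift_sum.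
under eq_bigr do rewrite tSl.
rewrite exchange_big st /=; apply: eq_bigr => -[a phi] _ /=.
under eq_bigr do rewrite tZ.
rewrite -tSr; congr (_ ⊗ _); apply/lfunP => v.
rewrite sum_lfunE [in LHS](vE v) linear_sum; apply: eq_bigr => i _.
rewrite linearZ scale_lfunE dual_vbasisE; exact: mulrC.
Qed.

(* The image of T under the inclusion of A ⊗ V^* in the tensor square of the
   direct sum of A and V^*. *)
Definition hom_tensor_sd (A : lmodType K) (T : V -> A) :=
  tmap (fun a : A => (a, 0 : dual)) (fun phi : dual => (0 : A, phi)) (hom_tensor T).

End Dual.

Section YangBaxter.
Variables (K : fieldType) (G : lmodType K).
Implicit Types (br : G -> G -> G) (M Q : G -> G) (r : G ⊗ G) (Delta : G -> G ⊗ G).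

Definition mlyb br r : G ⊗ (G ⊗ G) :=
  tlift (fun c d => tlift (fun c' d' =>
    br c c' ⊗ d ⊗ d' + c ⊗ c' ⊗ br d d' - c ⊗ br d c' ⊗ d') r) r.

Lemma mlyb_sum br (s : seq (G * G)) : bilinear_map br ->
  mlyb br (\sum_(p <- s) p.1 ⊗ p.2) =
  \sum_(p <- s) \sum_(q <- s)
    (br p.1 q.1 ⊗ p.2 ⊗ q.2 + p.1 ⊗ q.1 ⊗ br p.2 q.2 - p.1 ⊗ br p.2 q.1 ⊗ q.2).
Proof.
move=> brB; have [brr brl] := brB.
have [tr tl] := @tens_bilinear K G G.
have [tr3 tl3] := @tens_bilinear K G (G ⊗ G)%type.
have D3 k (x y z x' y' z' : G ⊗ (G ⊗ G)) :
    (k *: x + x') + (k *: y + y') - (k *: z + z') = k *: (x + y - z) + (x' + y' - z').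
  by rewrite [X in X - _]addrACA -scalerDr opprD addrACA -scalerBr.
pose F c d c' d' : G ⊗ (G ⊗ G) :=
  br c c' ⊗ d ⊗ d' + c ⊗ c' ⊗ br d d' - c ⊗ br d c' ⊗ d'.
have FB c d : bilinear_map (F c d).
  split=> [c' k d1 d2|d' k c1 c2]; rewrite /F -D3; congr (_ + _ - _).
  - by rewrite tr tr3.
  - by rewrite brr tr tr3.
  - by rewrite tr tr3.
  - by rewrite brr tl3.
  - by rewrite tl tr3.
  - by rewrite brr tl tr3.
pose r : G ⊗ G := \sum_(p <- s) p.1 ⊗ p.2.
have LE : (fun c d => tlift (F c d) r) = fun c d => \sum_(q <- s) F c d q.1 q.2.
  by apply/funext => c; apply/funext => d; apply: tlift_sum.
rewrite -[LHS]/(tlift (fun c d => tlift (F c d) r) r) LE.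
apply: tlift_sum; split=> [c k d1 d2|d k c1 c2];
  rewrite scaler_sumr -big_split; apply: eq_bigr => -[c' d'] _ /=;
  rewrite /F -D3; congr (_ + _ - _).
- by rewrite tl tr3.
- by rewrite brl tr tr3.
- by rewrite brl tl tr3.
- by rewrite brl tl3.
- by rewrite tl3.
- by rewrite tl3.
Qed.

Definition admissible_mlYBE br M Q r : Prop :=
  [/\ mlyb br r = 0,
      tmap M id r - tmap id Q r = 0 &
      tmap Q id r - tmap id M r = 0].

Definition antisymmetric_tensor r : Prop := r = - tflip r.

Record mock_lie_coalgebra Delta : Prop := {
  mlc_linear : linear Delta;
  mlc_cocomm : forall x,
    tlift (fun x1 x2 => x1 ⊗ x2) (Delta x) = tlift (fun x1 x2 => x2 ⊗ x1) (Delta x);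
  mlc_cojacobi : forall x,
    tlift (fun x1 x2 => tlift (fun x21 x22 => x1 ⊗ x21 ⊗ x22) (Delta x2)) (Delta x)
    + tlift (fun x1 x2 => tlift (fun x11 x12 => x11 ⊗ x12 ⊗ x2) (Delta x1)) (Delta x)
    + tlift (fun x1 x2 => tlift (fun x21 x22 => x21 ⊗ x1 ⊗ x22) (Delta x2)) (Delta x)
    = 0
}.

Record mock_lie_bialgebra br Delta : Prop := {
  mlb_mock_lie : mock_lie br;
  mlb_coalgebra : mock_lie_coalgebra Delta;
  mlb_compat : forall x y,
    Delta (br x y) =
      - tlift (fun y1 y2 => br x y1 ⊗ y2) (Delta y)
      - tlift (fun y1 y2 => y1 ⊗ br x y2) (Delta y)
      - tlift (fun x1 x2 => br y x1 ⊗ x2) (Delta x)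
      - tlift (fun x1 x2 => x1 ⊗ br y x2) (Delta x)
}.

Record nijenhuis_mock_lie_bialgebra br M Delta Q : Prop := {
  nmlb_bialgebra : mock_lie_bialgebra br Delta;
  nmlb_nijenhuis : nijenhuis_mock_lie br M;
  nmlb_linear : linear Q;
  nmlb_admissible : adjoint_admissible br M Q;
  nmlb_conijenhuis : forall x,
    tmap Q Q (Delta x) + Delta (Q (Q x)) =
    tmap Q id (Delta (Q x)) + tmap id Q (Delta (Q x));
  nmlb_coadmissible : forall x,
    tmap Q id (Delta (M x)) + tmap id (M \o M) (Delta x) =
    tmap Q M (Delta x) + tmap id M (Delta (M x))
}.

Definition coboundary br r (z : G) : G ⊗ G :=
  tlift (fun c d => br z c ⊗ d - c ⊗ br z d) r.

End YangBaxter.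

(* Main.v *)
Require Import Defs.
From HB Require Import structures.
From mathcomp Require Import all_boot all_algebra.

(** The theorem has two independent halves.

    The first is a general fact about a mock-Lie algebra G. Write r as a sum
    of c ⊗ d and let Delta(z) = [z, c] ⊗ d - c ⊗ [z, d] be its coboundary. If r
    is antisymmetric and solves the mock-Lie-Yang-Baxter equation, then Delta
    is a mock-Lie bialgebra coproduct: cocommutativity is antisymmetry of r,
    the compatibility of Delta with the bracket is the identity
    ad [x, y] = - ad x ad y - ad y ad x, and the co-Jacobi identity
    combines the Yang-Baxter equation, antisymmetry and Jacobi (lemmas cojacobi_outer1, cojacobi_outer2, cojacobi_outer3).
    If moreover (M ⊗ id) r = (id ⊗ Q) r and (Q ⊗ id) r = (id ⊗ M) r, the two
    operators can be carried from one leg of r to the other; the two conditions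
    on Delta and Q then become, leg by leg, the Nijenhuis identity of M and the
    adjoint admissibility of Q. This is coboundary_nijenhuis_bialgebra.

    The second half computes the equations for r = T - tau(T) in the semidirect
    product of A and the dual of V. With a basis e_i of V and the dual basis
    f_i, r is the sum of T e_i ⊗ f_i - f_i ⊗ T e_i. Moving every rho^*(x) off
    the f_i by the identity of the tensors sum T e_i ⊗ g^* f_i and
    sum T (g e_i) ⊗ f_i (sum_transpose), the Yang-Baxter expression becomes
    the sum over i, j of
      W_ij ⊗ f_i ⊗ f_j + f_i ⊗ W_ij ⊗ f_j + f_i ⊗ f_j ⊗ W_ij,
    where W_ij = [T e_i, T e_j] - T (rho(T e_i) e_j + rho(T e_j) e_i) measures
    the failure of T to be an O-operator (mlyb_hom). Its three parts lie in
    different summands of the tensor cube, so it vanishes exactly when W does;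
    the evaluation of the last two legs at vectors of V recovers W (mlyb_homP).
    The same method turns the two linear conditions on r into N T = T alpha
    and S T = T beta (intertwine_homP). *)

Set Implicit Arguments.
Unset Strict Implicit.
Unset Printing Implicit Defensive.

Import GRing.Theory.
Local Open Scope ring_scope.

(** * Linearity as a predicate *)

Section LinearCalculus.
Variables (K : fieldType) (U U' V V' W : lmodType K).

Lemma linD (f : U -> V) : linear f -> {morph f : x y / x + y}.
Proof. by move=> fL x y; have := fL 1 x y; rewrite !scale1r. Qed.

Lemma lin0 (f : U -> V) : linear f -> f 0 = 0.
Proof. by move=> fL; apply: (addrI (f 0)); rewrite -linD // !addr0. Qed.

Lemma linN (f : U -> V) : linear f -> {morph f : x / - x}.
Proof. by move=> fL x; have := fL (- 1) x 0; rewrite !scaleN1r (lin0 fL) !addr0. Qed.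

Lemma linZ (f : U -> V) : linear f -> forall k, {morph f : x / k *: x}.
Proof. by move=> fL k x; have := fL k x 0; rewrite (lin0 fL) !addr0. Qed.

Lemma lin_sum (f : U -> V) I (s : seq I) (F : I -> U) : linear f ->
  f (\sum_(i <- s) F i) = \sum_(i <- s) f (F i).
Proof. by move=> fL; apply: (big_morph f (linD fL) (lin0 fL)). Qed.

Lemma linear_id : linear (fun x : U => x).
Proof. by []. Qed.

Lemma linear_add (f g : U -> V) : linear f -> linear g ->
  linear (fun x => f x + g x).
Proof. by move=> fL gL k x y; rewrite fL gL scalerDr addrACA. Qed.

Lemma linear_opp (f : U -> V) : linear f -> linear (fun x => - f x).
Proof. by move=> fL k x y; rewrite fL opprD scalerN. Qed.

Lemma linear_bil (b : V -> V' -> W) (f : U -> V) y :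
  bilinear_map b -> linear f -> linear (fun x => b (f x) y).
Proof. by move=> [_ bl] fL k x x'; rewrite fL bl. Qed.

Lemma linear_bir (b : V -> V' -> W) (f : U -> V') y :
  bilinear_map b -> linear f -> linear (fun x => b y (f x)).
Proof. by move=> [br _] fL k x x'; rewrite fL br. Qed.

Lemma bilinear_linearr (b : V -> V' -> W) y : bilinear_map b -> linear (b y).
Proof. by case. Qed.

Lemma linear_tlift_arg (f : U -> V -> V' -> W) t :
  (forall c d, linear (fun x => f x c d)) -> linear (fun x => tlift (f x) t).
Proof.
move=> fL k x y; rewrite /tlift scaler_sumr -big_split.
by apply: eq_bigr => p _; apply: fL.
Qed.

Lemma linear_comp (f : {linear V -> W}) (g : U -> V) :
  linear g -> linear (fun x => f (g x)).
Proof. by move=> gL k x y; rewrite gL linearP. Qed.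

Lemma linear_scalel (f : U -> K^o) (v : V) :
  linear f -> linear (fun x => f x *: v).
Proof. by move=> fL k x y; rewrite fL scalerDl scalerA. Qed.

Lemma linear_scaler (f : U -> V) (k : K) :
  linear f -> linear (fun x => k *: f x).
Proof. by move=> fL a x y; rewrite fL scalerDr !scalerA mulrC. Qed.

End LinearCalculus.

(** Lets a linearity hypothesis be traded for a bundled linear map by
    substitution. *)
Lemma linear_pack (K : fieldType) (U V : lmodType K) (f : U -> V) :
  linear f -> exists g : {linear U -> V}, g = f :> (U -> V).
Proof.
move=> fL; pose gm := GRing.isLinear.Build K U V *:%R f fL.
by pose g : {linear U -> V} := HB.pack f gm; exists g.
Qed.

(** Linearity of a map built from sums, opposites, tensors, iterated lifts and
    the bilinear maps of the context is proved by structural descent. *)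
Ltac solve_linear :=
  repeat first
  [ exact: linear_id | by [] | by apply: linearP | by apply: tens_bilinear
  | apply: linear_add | apply: linear_opp
  | apply: linear_tlift_arg => ? ?
  | by apply: bilinear_linearr => //; apply: tens_bilinear
  | apply: linear_bil; [by [] | ] | apply: linear_bir; [by [] | ]
  | apply: linear_bil; [exact: tens_bilinear | ]
  | apply: linear_bir; [exact: tens_bilinear | ]
  | apply: linear_comp ].

Ltac solve_bilinear := split=> ? /=; solve_linear.

(** Proves an identity between signed sums in an abelian group: everything is
    moved to one side and each pair x, - x is brought to the front and cancelled.
    Tensors are first replaced by variables, so that two different ones are told
    apart without unfolding the tensor product. *)
Ltac zmod_cancel :=
  repeat match goal with |- context [ ?x ⊗ ?y ] => move: (x ⊗ y) => ? end;
  apply: subr0_eq; rewrite -[LHS]addr0 ?opprB ?opprD ?opprK -?addrA ?oppr0 ?add0r;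
  (* If x occurs twice, its occurrences can be exchanged at the front for ever;
     the bound exceeds the number of terms in every sum below. *)
  repeat match goal with |- context [ - ?x ] =>
    rewrite 24?(addrCA _ x) 24?(addrCA _ (- x)) addKr end;
  rewrite ?addr0 //.

(** * Sweedler calculus *)

Section TliftCalculus.
Variables (K : fieldType) (U V W W' : lmodType K).
Implicit Types (f g : U -> V -> W) (t : U ⊗ V).

Lemma eq_tlift f g t : (forall x y, f x y = g x y) -> tlift f t = tlift g t.
Proof. by move=> fg; apply: eq_bigr. Qed.

Lemma tlift_add f g t :
  tlift (fun x y => f x y + g x y) t = tlift f t + tlift g t.
Proof. exact: big_split. Qed.

Lemma tlift_opp f t : tlift (fun x y => - f x y) t = - tlift f t.
Proof. exact: sumrN. Qed.

Lemma tlift_comp (h : W -> W') f t : linear h ->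
  h (tlift f t) = tlift (fun x y => h (f x y)) t.
Proof. by move=> hL; apply: lin_sum. Qed.

Lemma tlift_id t : tlift (fun x y => x ⊗ y) t = t.
Proof.
by symmetry; apply: (tlift_unique (@tens_bilinear K U V) (g := fun t => t)).
Qed.

End TliftCalculus.

Lemma tlift_tlift (K : fieldType) (U V U' V' W : lmodType K) (f : U -> V -> W)
    (g : U' -> V' -> U ⊗ V) (t : U' ⊗ V') :
  bilinear_map f -> tlift f (tlift g t) = tlift (fun x y => tlift f (g x y)) t.
Proof. by move=> fB; exact: (tlift_comp _ _ (tlift_linear fB)). Qed.

Lemma tflip_bilinear (K : fieldType) (U V : lmodType K) :
  bilinear_map (fun (x : U) (y : V) => y ⊗ x).
Proof. by have [tr tl] := @tens_bilinear K V U. Qed.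

Lemma tflipK (K : fieldType) (U V : lmodType K) (t : U ⊗ V) :
  tflip (tflip t) = t.
Proof.
rewrite [tflip _]tlift_tlift; last exact: tflip_bilinear.
by rewrite -[RHS]tlift_id; apply: eq_tlift => x y; apply: tflip_tens.
Qed.

Lemma antisymmetric_sub_tflip (K : fieldType) (U : lmodType K) (t : U ⊗ U) :
  antisymmetric_tensor (t - tflip t).
Proof.
have fL : linear (@tflip K U U) by apply/tlift_linear/tflip_bilinear.
by rewrite /antisymmetric_tensor (linD fL) (linN fL) tflipK opprB.
Qed.

Section LegCalculus.
Variables (K : fieldType) (G : lmodType K).

(** The only way in which antisymmetry is used: the two legs of [r] may be
    exchanged at the cost of a sign. *)
Lemma tlift_antisym (W : lmodType K) (f : G -> G -> W) r :
  antisymmetric_tensor r -> bilinear_map f ->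
  tlift f r = - tlift (fun c d => f d c) r.
Proof.
move=> rA fB; rewrite {1}rA (linN (tlift_linear fB)) tlift_tlift //.
by congr (- _); apply: eq_tlift => c d; rewrite tlift_tens.
Qed.

Lemma tlift_tmap (W : lmodType K) (f : G -> G -> W) (g h : {linear G -> G}) t :
  bilinear_map f ->
  tlift f (tmap g h t) = tlift (fun x y => f (g x) (h y)) t.
Proof.
by move=> fB; rewrite tlift_tlift //; apply: eq_tlift => x y; rewrite tlift_tens.
Qed.

(** The equation (g ⊗ id) r = (id ⊗ h) r lets an operator on the first leg
    of [r] reappear as another one on the second leg. *)
Lemma tlift_intertwine (W : lmodType K) (f : G -> G -> W) (g h : {linear G -> G}) r :
  tmap g id r - tmap id h r = 0 -> bilinear_map f ->
  tlift (fun c d => f (g c) d) r = tlift (fun c d => f c (h d)) r.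
Proof.
move=> E fB; rewrite -(@tlift_tmap _ f g idfun) // -(@tlift_tmap _ f idfun h) //.
by congr tlift; apply: subr0_eq.
Qed.

(** The sum over two independent copies of [r], in Sweedler notation. *)
Definition tlift2 (W : lmodType K) (F : G -> G -> G -> G -> W) (r : G ⊗ G) : W :=
  tlift (fun c d => tlift (F c d) r) r.

Section Tlift2.
Variables (W : lmodType K) (r : G ⊗ G).
Implicit Types F H : G -> G -> G -> G -> W.

Lemma eq_tlift2 F H : (forall c d c' d', F c d c' d' = H c d c' d') ->
  tlift2 F r = tlift2 H r.
Proof. by move=> FH; apply: eq_tlift => c d; apply: eq_tlift. Qed.

Lemma tlift2_add F H :
  tlift2 (fun c d c' d' => F c d c' d' + H c d c' d') r = tlift2 F r + tlift2 H r.
Proof. by rewrite -tlift_add; apply: eq_tlift => c d; apply: tlift_add. Qed.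

Lemma tlift2_opp F : tlift2 (fun c d c' d' => - F c d c' d') r = - tlift2 F r.
Proof. by rewrite -tlift_opp; apply: eq_tlift => c d; apply: tlift_opp. Qed.

Lemma tlift2_exchange F :
  tlift2 F r = tlift2 (fun c d c' d' => F c' d' c d) r.
Proof. exact: exchange_big. Qed.

Lemma tlift2_antisym F : antisymmetric_tensor r ->
  (forall c' d', bilinear_map (fun c d => F c d c' d')) ->
  tlift2 F r = - tlift2 (fun c d c' d' => F d c c' d') r.
Proof.
move=> rA FB; apply: (tlift_antisym rA).
by split=> x /=; apply: linear_tlift_arg => c' d'; have [] := FB c' d'.
Qed.

End Tlift2.

Definition tlift3 (W : lmodType K) (F : G -> G -> G -> W) : G ⊗ (G ⊗ G) -> W :=
  tlift (fun x t => tlift (F x) t).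

Definition trilinear_map (W : lmodType K) (F : G -> G -> G -> W) :=
  [/\ forall y w, linear (fun x => F x y w),
      forall x w, linear (fun y => F x y w) &
      forall x y, linear (fun w => F x y w)].

Section Tlift3.
Variables (W : lmodType K) (F : G -> G -> G -> W).
Hypothesis FT : trilinear_map F.

Let FB x : bilinear_map (F x).
Proof. by case: FT => _ F2 F3; split=> y; [apply: F3 | apply: F2]. Qed.

Let F3B : bilinear_map (fun x t => tlift (F x) t).
Proof.
case: FT => F1 _ _; split=> [x|t]; first exact: tlift_linear.
by apply: linear_tlift_arg => c d; apply: F1.
Qed.

Lemma tlift3_linear : linear (tlift3 F).
Proof. exact: tlift_linear. Qed.

Lemma tlift3_tens x y w : tlift3 F (x ⊗ y ⊗ w) = F x y w.
Proof. by rewrite /tlift3 !tlift_tens. Qed.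

End Tlift3.

End LegCalculus.

(** * Coboundary coproducts *)

Section Coboundary.
Variables (K : fieldType) (G : lmodType K) (br : G -> G -> G).

Lemma tlift_coboundary (W : lmodType K) (f : G -> G -> W) r z :
  bilinear_map f -> tlift f (coboundary br r z) =
  tlift (fun c d => f (br z c) d - f c (br z d)) r.
Proof.
move=> fB; rewrite tlift_tlift //; apply: eq_tlift => c d.
by rewrite (linD (tlift_linear fB)) (linN (tlift_linear fB)) !tlift_tens.
Qed.

Lemma tlift3_mlyb (W : lmodType K) (F : G -> G -> G -> W) r :
  trilinear_map F -> tlift3 F (mlyb br r) =
  tlift2 (fun c d c' d' => F (br c c') d d' + F c c' (br d d') - F c (br d c') d') r.
Proof.
move=> FT; have FL := tlift3_linear FT.
rewrite (tlift_comp _ _ FL); apply: eq_tlift => c d.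
rewrite (tlift_comp _ _ FL); apply: eq_tlift => c' d'.
by rewrite !(linD FL) (linN FL) !tlift3_tens.
Qed.

(** What the Yang-Baxter equation says after any trilinear map is applied to its
    three legs. *)
Lemma mlyb_tlift_eq (W : lmodType K) (F : G -> G -> G -> W) r :
  mlyb br r = 0 -> trilinear_map F ->
  tlift2 (fun c d c' d' => F (br c c') d d') r
  + tlift2 (fun c d c' d' => F c c' (br d d')) r
  = tlift2 (fun c d c' d' => F c (br d c') d') r.
Proof.
move=> r0 FT; apply: subr0_eq; rewrite -tlift2_opp -!tlift2_add.
by rewrite -tlift3_mlyb // r0 (lin0 (tlift3_linear _)).
Qed.

Hypothesis brM : mock_lie br.
Let brB := ml_bilinear brM.
Variable r : G ⊗ G.

Lemma coboundary_linear : linear (coboundary br r).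
Proof. by apply: linear_tlift_arg => c d; solve_linear. Qed.

Lemma coboundary_compat x y :
    coboundary br r (br x y) =
      - tlift (fun y1 y2 => br x y1 ⊗ y2) (coboundary br r y)
      - tlift (fun y1 y2 => y1 ⊗ br x y2) (coboundary br r y)
      - tlift (fun x1 x2 => br y x1 ⊗ x2) (coboundary br r x)
      - tlift (fun x1 x2 => x1 ⊗ br y x2) (coboundary br r x).
Proof.
rewrite !tlift_coboundary; try by solve_bilinear.
rewrite -!tlift_opp -!tlift_add; apply: eq_tlift => c d.
have E w : br (br x y) w = - br x (br y w) - br y (br x w).
  apply/eqP; rewrite -opprD -addr_eq0 (ml_comm brM) addrC [br x w](ml_comm brM).
  by rewrite -addrA addrC (ml_jacobi brM).
rewrite !E.
have [tr tl] := @tens_bilinear K G G.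
rewrite !(linD (tl _), linD (tr _), linN (tl _), linN (tr _)) /=.
by zmod_cancel.
Qed.

Lemma coboundary_cocomm x : antisymmetric_tensor r ->
  tlift (fun x1 x2 => x1 ⊗ x2) (coboundary br r x) =
  tlift (fun x1 x2 => x2 ⊗ x1) (coboundary br r x).
Proof.
move=> rA; rewrite !tlift_coboundary; try by solve_bilinear.
rewrite (tlift_antisym rA); last by solve_bilinear.
by rewrite -tlift_opp; apply: eq_tlift => c d; rewrite opprB.
Qed.

Section CoJacobi.
Variable x : G.
Hypothesis rA : antisymmetric_tensor r.
Hypothesis rY : mlyb br r = 0.
Let YB (F : G -> G -> G -> G ⊗ (G ⊗ G)) := @mlyb_tlift_eq _ F r rY.

(** Each of the three summands of the co-Jacobi identity expands into four double
    sums. In two of them [x] acts on another leg than the bracket of the two copies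
    of [r]; the Yang-Baxter equation with ad x applied to that leg merges them into
    one. What remains has one double bracket in each of the three legs. *)
Lemma cojacobi_outer1 :
  tlift (fun x1 x2 => tlift (fun x21 x22 => x1 ⊗ x21 ⊗ x22) (coboundary br r x2))
    (coboundary br r x) =
    tlift2 (fun c d c' d' => br x (br c c') ⊗ d ⊗ d') r
  - tlift2 (fun c d c' d' => c ⊗ br (br x d) c' ⊗ d') r
  + tlift2 (fun c d c' d' => c ⊗ c' ⊗ br (br x d) d') r.
Proof.
rewrite (@eq_tlift _ _ _ _ _ (fun x1 x2 =>
    tlift (fun c d => x1 ⊗ br x2 c ⊗ d - x1 ⊗ c ⊗ br x2 d) r)); last first.
  by move=> x1 x2; rewrite tlift_coboundary //; solve_bilinear.
rewrite tlift_coboundary; last by solve_bilinear.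
have -> : tlift2 (fun c d c' d' => br x (br c c') ⊗ d ⊗ d') r =
    tlift2 (fun c d c' d' => br x c ⊗ br d c' ⊗ d') r
    - tlift2 (fun c d c' d' => br x c ⊗ c' ⊗ br d d') r.
  by rewrite -(YB (F := fun a b c => br x a ⊗ b ⊗ c)) ?addrK //; split=> *; solve_linear.
rewrite -!tlift2_opp -!tlift2_add; apply: eq_tlift => c d.
rewrite -tlift_opp -tlift_add; apply: eq_tlift => c' d'.
by zmod_cancel.
Qed.

Lemma cojacobi_outer2 :
  tlift (fun x1 x2 => tlift (fun x21 x22 => x21 ⊗ x1 ⊗ x22) (coboundary br r x2))
    (coboundary br r x) =
    tlift2 (fun c d c' d' => br (br x c) c' ⊗ d ⊗ d') r
  - tlift2 (fun c d c' d' => c ⊗ br x (br d c') ⊗ d') r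
  + tlift2 (fun c d c' d' => c ⊗ c' ⊗ br (br x d') d) r.
Proof.
rewrite (@eq_tlift _ _ _ _ _ (fun x1 x2 =>
    tlift (fun c d => br x2 c ⊗ x1 ⊗ d - c ⊗ x1 ⊗ br x2 d) r)); last first.
  by move=> x1 x2; rewrite tlift_coboundary //; solve_bilinear.
rewrite tlift_coboundary; last by solve_bilinear.
rewrite -(YB (F := fun a b c => a ⊗ br x b ⊗ c)); last by split=> *; solve_linear.
(* Here the middle factor is the outer leg of the first copy of r, so two of the
   sums match only after that copy is flipped. *)
rewrite (tlift2_antisym (F := fun c d c' d' => br (br x c) c' ⊗ d ⊗ d')) //;
  last by move=> *; solve_bilinear.
rewrite [X in _ - (X + _)](tlift2_antisym (F := fun c d c' d' => br c c' ⊗ br x d ⊗ d')) //;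
  last by move=> *; solve_bilinear.
rewrite [X in _ - (_ + X)]tlift2_exchange [X in _ = _ + X]tlift2_exchange.
rewrite -!tlift2_opp -!tlift2_add -!tlift2_opp -!tlift2_add; apply: eq_tlift => c d.
rewrite -tlift_opp -tlift_add; apply: eq_tlift => c' d'.
rewrite [br d' d](ml_comm brM).
by zmod_cancel.
Qed.

Lemma cojacobi_outer3 :
  tlift (fun x1 x2 => tlift (fun x11 x12 => x11 ⊗ x12 ⊗ x2) (coboundary br r x1))
    (coboundary br r x) =
    tlift2 (fun c d c' d' => br (br x c') c ⊗ d ⊗ d') r
  - tlift2 (fun c d c' d' => c ⊗ br (br x c') d ⊗ d') r
  + tlift2 (fun c d c' d' => c ⊗ c' ⊗ br x (br d d')) r.
Proof.
rewrite (@eq_tlift _ _ _ _ _ (fun x1 x2 =>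
    tlift (fun c d => br x1 c ⊗ d ⊗ x2 - c ⊗ br x1 d ⊗ x2) r)); last first.
  by move=> x1 x2; rewrite tlift_coboundary //; solve_bilinear.
rewrite tlift_coboundary; last by solve_bilinear.
have -> : tlift2 (fun c d c' d' => c ⊗ c' ⊗ br x (br d d')) r =
    tlift2 (fun c d c' d' => c ⊗ br d c' ⊗ br x d') r
    - tlift2 (fun c d c' d' => br c c' ⊗ d ⊗ br x d') r.
  by rewrite -(YB (F := fun a b c => a ⊗ b ⊗ br x c)) ?[_ + _ - _]addrAC ?subrr ?add0r //;
    split=> *; solve_linear.
rewrite [RHS]addrC -!tlift2_opp -!tlift2_add tlift2_exchange; apply: eq_tlift => c d.
rewrite -tlift_opp -tlift_add; apply: eq_tlift => c' d'.
rewrite [br c' c](ml_comm brM) [br d' c](ml_comm brM).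
by zmod_cancel.
Qed.

(** After the reductions above each leg carries the Jacobi sum of [x] and one
    leg from each copy of [r]. *)
Lemma coboundary_cojacobi :
  tlift (fun x1 x2 => tlift (fun x21 x22 => x1 ⊗ x21 ⊗ x22) (coboundary br r x2))
    (coboundary br r x)
  + tlift (fun x1 x2 => tlift (fun x11 x12 => x11 ⊗ x12 ⊗ x2) (coboundary br r x1))
    (coboundary br r x)
  + tlift (fun x1 x2 => tlift (fun x21 x22 => x21 ⊗ x1 ⊗ x22) (coboundary br r x2))
    (coboundary br r x)
  = 0.
Proof.
have JE a b c : br a (br b c) + br (br a b) c + br (br a c) b = 0.
  have := ml_jacobi brM a b c.
  by rewrite [br b (br c a)](ml_comm brM) [br c (br a b)](ml_comm brM) [br c a](ml_comm brM) addrAC.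
have [tr tl] := @tens_bilinear K G G.
have [tr3 tl3] := @tens_bilinear K G (G ⊗ G)%type.
rewrite cojacobi_outer1 cojacobi_outer2 cojacobi_outer3 -!tlift2_opp -!tlift2_add.
rewrite [RHS](_ : 0 = tlift2 (fun _ _ _ _ => 0) r); last first.
  by rewrite /tlift2 /tlift big1 // => *; rewrite big1.
apply: eq_tlift2 => c d c' d'.
transitivity ((br x (br c c') + br (br x c) c' + br (br x c') c) ⊗ d ⊗ d'
  - c ⊗ (br x (br d c') + br (br x d) c' + br (br x c') d) ⊗ d'
  + c ⊗ c' ⊗ (br x (br d d') + br (br x d) d' + br (br x d') d)).
  rewrite !(linD (tl _), linD (tr _), linD (tl3 _), linD (tr3 _)) /=.
  by zmod_cancel.
by rewrite !JE (lin0 (tl3 _)) (lin0 (tl _)) !(lin0 (tr _)) !(lin0 (tr3 _)) subrr addr0.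
Qed.

End CoJacobi.

Lemma coboundary_bialgebra : antisymmetric_tensor r -> mlyb br r = 0 ->
  mock_lie_bialgebra br (coboundary br r).
Proof.
move=> rA rY; split=> //; last exact: coboundary_compat.
by split=> [|x|x]; [apply: coboundary_linear|apply: coboundary_cocomm|apply: coboundary_cojacobi].
Qed.

Section Nijenhuis.
Variables M Q : {linear G -> G}.
Hypothesis MN : nijenhuis_mock_lie br M.
Hypothesis MQ : adjoint_admissible br M Q.
Hypothesis rMQ : tmap M id r - tmap id Q r = 0.
Hypothesis rQM : tmap Q id r - tmap id M r = 0.

Lemma tmap_coboundary (g h : {linear G -> G}) z :
  tmap g h (coboundary br r z) =
  tlift (fun c d => g (br z c) ⊗ h d - g c ⊗ h (br z d)) r.
Proof. by apply: tlift_coboundary; split=> ? /=; solve_linear. Qed.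

(** Both conditions are identities between terms in which the operators act on
    both legs. Carrying the outer operator from the leg without the bracket to
    the leg with the bracket leaves, on the first leg, the adjoint admissibility
    of [Q], and on the second leg the same (for the coproduct and [Q]) or the
    Nijenhuis identity of [M] (for the mixed condition). *)
Lemma coboundary_nijenhuis_bialgebra :
  antisymmetric_tensor r -> mlyb br r = 0 ->
  nijenhuis_mock_lie_bialgebra br M (coboundary br r) Q.
Proof.
move=> rA rY; have brC := ml_comm brM.
have [tr tl] := @tens_bilinear K G G.
split=> // [||z|z].
- exact: coboundary_bialgebra.
- exact: linearP.
- rewrite (tmap_coboundary Q Q) (tmap_coboundary Q idfun) (tmap_coboundary idfun Q) /=.
  rewrite /coboundary !tlift_add !tlift_opp.
  rewrite -(tlift_intertwine (f := fun c d => Q (br z c) ⊗ d) rMQ); last by solve_bilinear.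
  rewrite -(tlift_intertwine (f := fun c d => br (Q z) c ⊗ d) rMQ); last by solve_bilinear.
  rewrite (tlift_intertwine (f := fun c d => c ⊗ Q (br z d)) rQM); last by solve_bilinear.
  rewrite (tlift_intertwine (f := fun c d => c ⊗ br (Q z) d) rQM); last by solve_bilinear.
  rewrite -!tlift_opp -!tlift_add; apply: eq_tlift => c d.
  have EQ w : Q (br z (M w)) + br (Q (Q z)) w = br (Q z) (M w) + Q (br (Q z) w).
    by rewrite ![br z _]brC ![br (Q _) _]brC MQ.
  transitivity ((Q (br z (M c)) + br (Q (Q z)) c) ⊗ d - c ⊗ (Q (br z (M d)) + br (Q (Q z)) d)).
    rewrite !(linD (tl _), linD (tr _)).
    by zmod_cancel.
  rewrite !EQ !(linD (tl _), linD (tr _)).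
  by zmod_cancel.
- rewrite (tmap_coboundary Q M) (tmap_coboundary Q idfun) (tmap_coboundary idfun (M \o M))
    (tmap_coboundary idfun M) /=.
  rewrite !tlift_add !tlift_opp.
  rewrite (tlift_intertwine (f := fun c d => c ⊗ br (M z) d) rQM); last by solve_bilinear.
  rewrite (tlift_intertwine (f := fun c d => c ⊗ M (br z d)) rQM); last by solve_bilinear.
  rewrite -(tlift_intertwine (f := fun c d => br z c ⊗ M d) rQM); last by solve_bilinear.
  rewrite -(tlift_intertwine (f := fun c d => br z (Q c) ⊗ d) rQM); last by solve_bilinear.
  rewrite -(tlift_intertwine (f := fun c d => Q (br z c) ⊗ d) rQM); last by solve_bilinear.
  rewrite -(tlift_intertwine (f := fun c d => br (M z) c ⊗ d) rQM); last by solve_bilinear.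
  rewrite -!tlift_opp -!tlift_add; apply: eq_tlift => c d.
  transitivity ((Q (br (M z) c) + br z (Q (Q c))) ⊗ d - c ⊗ (br (M z) (M d) + M (M (br z d)))).
    rewrite !(linD (tl _), linD (tr _)).
    by zmod_cancel.
  rewrite MQ (nml_nijenhuis MN) !(linD (tl _), linD (tr _)).
  by zmod_cancel.
Qed.

End Nijenhuis.

End Coboundary.

(** * Semidirect products *)

Section SemidirectMaps.
Variables (K : fieldType) (A : lmodType K) (V : vectType K).

Definition inA (a : A) : A * V := (a, 0).
Definition inV (u : V) : A * V := (0, u).

Lemma inA_linear : linear inA.
Proof. by move=> k a b; congr (_, _); rewrite /= scaler0 addr0. Qed.

Lemma inV_linear : linear inV.
Proof. by move=> k a b; congr (_, _); rewrite /= scaler0 addr0. Qed.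

HB.instance Definition _ := GRing.isLinear.Build K A (A * V)%type *:%R inA inA_linear.
HB.instance Definition _ := GRing.isLinear.Build K V (A * V)%type *:%R inV inV_linear.

Lemma sum_op_linear (f : {linear A -> A}) (g : 'End(V)) : linear (sum_op f g).
Proof. by move=> k x y; congr (_, _); rewrite /= linearP. Qed.

HB.instance Definition _ (f : {linear A -> A}) (g : 'End(V)) :=
  GRing.isLinear.Build K (A * V)%type (A * V)%type *:%R (sum_op f g) (sum_op_linear f g).

Lemma sum_op_inA (f : A -> A) (g : 'End(V)) a : sum_op f g (inA a) = inA (f a).
Proof. by congr (_, _); rewrite linear0. Qed.

Lemma sum_op_inV (f : {linear A -> A}) (g : 'End(V)) u :
  sum_op f g (inV u) = inV (g u).
Proof. by congr (_, _); rewrite /= linear0. Qed.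

Variables (br : A -> A -> A) (rho : A -> 'End(V)).
Hypothesis brB : bilinear_map br.
Hypothesis rhoL : linear rho.

Lemma semidirect_AA a b : semidirect br rho (inA a) (inA b) = inA (br a b).
Proof. by congr (_, _); rewrite /= !linear0 addr0. Qed.

Lemma semidirect_AV a u : semidirect br rho (inA a) (inV u) = inV (rho a u).
Proof. by congr (_, _); rewrite /= ?linear0 ?addr0 // bilinear_map0r. Qed.

Lemma semidirect_VA a u : semidirect br rho (inV u) (inA a) = inV (rho a u).
Proof. by congr (_, _); rewrite /= ?linear0 ?add0r // bilinear_map0l. Qed.

Lemma semidirect_VV u v : semidirect br rho (inV u) (inV v) = 0.
Proof.
congr (_, _); rewrite /= ?bilinear_map0l //.
by rewrite (lin0 rhoL) !zero_lfunE addr0.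
Qed.

End SemidirectMaps.

Section DualRepresentation.
Variables (K : fieldType) (A : lmodType K) (V : vectType K).
Variables (br : A -> A -> A) (rho : A -> 'End(V)).
Hypothesis brB : bilinear_map br.
Hypothesis rhoL : linear rho.

Lemma transpose_linear : linear (@transpose K V).
Proof.
move=> k f g; apply/lfunP => phi; apply/lfunP => v.
rewrite add_lfunE scale_lfunE transposeE !add_lfunE !scale_lfunE.
by rewrite !transposeE linearP.
Qed.

Lemma dual_rep_linear : linear (dual_rep rho).
Proof. by move=> k x y; rewrite /dual_rep rhoL transpose_linear. Qed.

Lemma semidirect_bilinear : bilinear_map (semidirect br (dual_rep rho)).
Proof.
have [Lr Ll] := brB; have dL := dual_rep_linear.
by split=> [x k y z|x k y z]; rewrite /semidirect /=; congr (_, _);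
  rewrite ?Lr ?Ll //= dL add_lfunE scale_lfunE linearP scalerDr addrACA.
Qed.

(** The A-component is the admissibility of [S]. The component in V^*, paired with
    a vector, is the sum of the representation identity of [alpha] under the
    functional [psi] of the second argument and of the condition on [beta] under
    the functional [phi] of the first. *)
Lemma semidirect_adjoint_admissible (N : A -> A) (S : {linear A -> A})
    (alpha beta : 'End(V)) :
  nml_rep br N rho alpha -> adjoint_admissible br N S ->
  (forall y u, beta (rho y (alpha u)) + rho (S (S y)) u =
               rho (S y) (alpha u) + beta (rho (S y) u)) ->
  adjoint_admissible (semidirect br (dual_rep rho))
    (sum_op N (transpose beta)) (sum_op S (transpose alpha)).
Proof.
move=> alphaR SA rhoS [x phi] [y psi]; congr (_, _); first exact: SA.
apply/lfunP => u; rewrite /= !linearD !add_lfunE !transposeE.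
rewrite addrACA [in RHS]addrACA -!(linearD psi) -!(linearD phi).
by rewrite (nmlr_nijenhuis alphaR) rhoS [beta _ + _]addrC.
Qed.

End DualRepresentation.

(** * The tensor of a linear map *)

Section HomTensor.
Variables (K : fieldType) (A : lmodType K) (V : vectType K).
Implicit Type T : {linear V -> A}.

Local Notation e i := ((vbasis {:V})`_i).
Local Notation f_ i := (@dual_vbasis K V i).
Local Notation G := (A * dual V)%type.

Lemma sum_dual_vbasis (W : lmodType K) (L : V -> W) v : linear L ->
  \sum_(i < \dim {:V}) (f_ i v : K) *: L (e i) = L v.
Proof.
move=> LL; rewrite {2}(coord_vbasis (memvf v)) (lin_sum _ _ LL).
by apply: eq_bigr => i _; rewrite (linZ LL) dual_vbasisE.
Qed.

Lemma eval_bilinear v :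
  bilinear_map (fun (a : A) (phi : dual V) => (phi v : K) *: a).
Proof.
split=> [a k phi psi|phi k a b].
  by rewrite add_lfunE scale_lfunE scalerDl -scalerA.
by rewrite scalerDr !scalerA mulrC.
Qed.

(** Both sides are images of the same element of A ⊗ V^*, the one that
    corresponds to T \o g. *)
Lemma sum_transpose (W : lmodType K) (F : A -> dual V -> W) T (g : 'End(V)) :
  bilinear_map F ->
  \sum_(i < \dim {:V}) F (T (e i)) (transpose g (f_ i)) = \sum_(i < \dim {:V}) F (T (g (e i))) (f_ i).
Proof.
move=> FB.
have E : \sum_(i < \dim {:V}) T (e i) ⊗ transpose g (f_ i) = hom_tensor (T \o g).
  apply/hom_tensorP => v; rewrite tlift_bigsum; last exact: eval_bilinear.
  rewrite -[RHS](sum_dual_vbasis (L := T)) /=; last exact: linearP.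
  by apply: eq_bigr => i _; rewrite tlift_tens ?transposeE //; apply: eval_bilinear.
have := congr1 (tlift F) E; rewrite /hom_tensor !tlift_bigsum //=.
by under eq_bigr do rewrite tlift_tens //; under [in RHS]eq_bigr do rewrite tlift_tens //.
Qed.

Lemma tlift_hom (W : lmodType K) (F : G -> G -> W) T : bilinear_map F ->
  tlift F (hom_tensor_sd T - tflip (hom_tensor_sd T)) =
  \sum_(i < \dim {:V}) (F (inA _ (T (e i))) (inV _ (f_ i)) - F (inV _ (f_ i)) (inA _ (T (e i)))).
Proof.
move=> FB; have FL := tlift_linear FB.
have hE (f : G -> G -> W) : bilinear_map f ->
    tlift f (hom_tensor_sd T) = \sum_(i < \dim {:V}) f (inA _ (T (e i))) (inV _ (f_ i)).
  move=> fB; rewrite [LHS]tlift_tlift //.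
  transitivity (tlift (fun a phi => f (inA (dual V) a) (inV A phi)) (hom_tensor T)).
    by apply: eq_tlift => a phi; rewrite tlift_tens.
  have fB' : bilinear_map (fun a phi => f (inA (dual V) a) (inV A phi)).
    by solve_bilinear.
  by rewrite tlift_bigsum //; apply: eq_bigr => i _; rewrite tlift_tens.
rewrite (linD FL) (linN FL) [tlift F (tflip _)]tlift_tlift // big_split sumrN hE //; congr (_ - _).
rewrite -(hE (fun x y => F y x)); last by case: FB.
by apply: eq_tlift => x y; rewrite tlift_tens.
Qed.

Section Intertwining.
Variables (X Y : {linear A -> A}) (alpha beta : 'End(V)) (T : {linear V -> A}).
Let r : G ⊗ G := hom_tensor_sd T - tflip (hom_tensor_sd T).

Lemma intertwine_hom :
  tmap (sum_op X (transpose beta)) id r - tmap id (sum_op Y (transpose alpha)) r =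
  \sum_(i < \dim {:V}) (inA _ (X (T (e i)) - T (alpha (e i))) ⊗ inV _ (f_ i)
          + inV _ (f_ i) ⊗ inA _ (Y (T (e i)) - T (beta (e i)))).
Proof.
have [tr tl] := @tens_bilinear K G G.
rewrite /tmap !tlift_hom; try by solve_bilinear.
under eq_bigr do rewrite sum_op_inA sum_op_inV.
under [X in _ - X]eq_bigr do rewrite sum_op_inA sum_op_inV.
under [RHS]eq_bigr do rewrite !linearB !(linD (tl _), linN (tl _), linD (tr _), linN (tr _)).
rewrite !big_split !sumrN /=.
rewrite (sum_transpose (F := fun a phi => inV _ phi ⊗ inA _ a)); last by solve_bilinear.
rewrite (sum_transpose (F := fun a phi => inA _ a ⊗ inV _ phi)); last by solve_bilinear.
by zmod_cancel.
Qed.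

(** The two parts of the sum lie in A ⊗ V^* and V^* ⊗ A; evaluating the leg in
    V^* at a vector isolates each of them. *)
Lemma intertwine_homP :
  tmap (sum_op X (transpose beta)) id r - tmap id (sum_op Y (transpose alpha)) r = 0
  <-> (forall v, X (T v) = T (alpha v)) /\ (forall v, Y (T v) = T (beta v)).
Proof.
rewrite intertwine_hom; split=> [E|[XT YT]]; last first.
  have tB := @tens_bilinear K G G.
  rewrite big1 // => i _; rewrite XT YT !subrr !linear0.
  by rewrite (bilinear_map0l tB) (bilinear_map0r tB) addr0.
have B1 v : bilinear_map (fun x y : G => (y.2 v : K) *: x.1).
  have [Er El] := eval_bilinear v.
  by split=> [x k y y'|y k x x'] /=; [apply: Er | apply: El].
have B2 v : bilinear_map (fun x y : G => (x.2 v : K) *: y.1) by case: (B1 v).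
split=> v; apply: subr0_eq.
- have := congr1 (tlift (fun x y : G => (y.2 v : K) *: x.1)) E.
  rewrite (lin0 (tlift_linear (B1 v))) tlift_bigsum //.
  under eq_bigr do rewrite (linD (tlift_linear (B1 v))) !tlift_tens //= zero_lfunE scale0r addr0.
  rewrite (sum_dual_vbasis (L := fun v => X (T v) - T (alpha v))) //.
  by solve_linear.
- have := congr1 (tlift (fun x y : G => (x.2 v : K) *: y.1)) E.
  rewrite (lin0 (tlift_linear (B2 v))) tlift_bigsum //.
  under eq_bigr do rewrite (linD (tlift_linear (B2 v))) !tlift_tens //= zero_lfunE scale0r add0r.
  rewrite (sum_dual_vbasis (L := fun v => Y (T v) - T (beta v))) //.
  by solve_linear.
Qed.

End Intertwining.
End HomTensor.

(** * The Yang-Baxter expression *)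

Section YangBaxterHom.
Variables (K : fieldType) (A : lmodType K) (V : vectType K).
Variables (br : A -> A -> A) (rho : A -> 'End(V)) (T : {linear V -> A}).
Hypothesis brB : bilinear_map br.
Hypothesis rhoL : linear rho.

Local Notation e i := ((vbasis {:V})`_i).
Local Notation f_ i := (@dual_vbasis K V i).
Local Notation D := (dual V).
Local Notation G := (A * D)%type.
Local Notation brG := (semidirect br (dual_rep rho)).
Local Notation iA := (inA D).
Local Notation iV := (inV A).
Let r : G ⊗ G := hom_tensor_sd T - tflip (hom_tensor_sd T).

Definition O_defect (u v : V) : A := br (T u) (T v) - T (rho (T u) v + rho (T v) u).

Lemma O_defect_bilinear : bilinear_map O_defect.
Proof.
have [Lr Ll] := brB.
split=> [u|v] k x y; rewrite /O_defect !linearP ?Lr ?Ll rhoL add_lfunE scale_lfunE.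
all: by rewrite !linearD !linearZ /= !scalerN; zmod_cancel.
Qed.

(** Four pairs of summands of [r] in three terms make twelve double sums. The
    three that bracket two elements of V^* vanish; in the nine others every rho^*
    is moved to [T] by [sum_transpose]. *)
Lemma mlyb_hom :
  mlyb brG r = \sum_(i < \dim {:V}) \sum_(j < \dim {:V})
    (iA (O_defect (e i) (e j)) ⊗ iV (f_ i) ⊗ iV (f_ j)
     + iV (f_ i) ⊗ iA (O_defect (e i) (e j)) ⊗ iV (f_ j)
     + iV (f_ i) ⊗ iV (f_ j) ⊗ iA (O_defect (e i) (e j))).
Proof.
have sB := semidirect_bilinear brB rhoL; have dL := dual_rep_linear rhoL.
have [tr tl] := @tens_bilinear K G G.
have [tr3 tl3] := @tens_bilinear K G (G ⊗ G)%type.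
have tB := @tens_bilinear K G G; have tB3 := @tens_bilinear K G (G ⊗ G)%type.
pose dsum (F : 'I_(\dim {:V}) -> 'I_(\dim {:V}) -> G ⊗ (G ⊗ G)) := \sum_i \sum_j F i j.
have dsumD F H : dsum (fun i j => F i j + H i j) = dsum F + dsum H.
  by rewrite -big_split; apply: eq_bigr => i _; rewrite -big_split.
have dsumN F : dsum (fun i j => - F i j) = - dsum F.
  by rewrite -sumrN; apply: eq_bigr => i _; rewrite sumrN.
have dsumX F : dsum F = dsum (fun i j => F j i) by apply: exchange_big.
have dsumT (F : dual V -> A -> dual V -> G ⊗ (G ⊗ G)) :
    (forall u, bilinear_map (F u)) ->
    dsum (fun i j => F (f_ i) (T (e j)) (dual_rep rho (T (e i)) (f_ j))) =
    dsum (fun i j => F (f_ i) (T (rho (T (e i)) (e j))) (f_ j)).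
  by move=> FB; apply: eq_bigr => i _; apply: sum_transpose.
rewrite /mlyb {1}/r tlift_hom; last by solve_bilinear.
transitivity (dsum (fun i j =>
   iA (br (T (e i)) (T (e j))) ⊗ iV (f_ i) ⊗ iV (f_ j)
   - iA (T (e i)) ⊗ iV (dual_rep rho (T (e j)) (f_ i)) ⊗ iV (f_ j)
   - iV (dual_rep rho (T (e i)) (f_ j)) ⊗ iV (f_ i) ⊗ iA (T (e j))
   - iA (T (e i)) ⊗ iV (f_ j) ⊗ iV (dual_rep rho (T (e j)) (f_ i))
   - iV (dual_rep rho (T (e j)) (f_ i)) ⊗ iA (T (e i)) ⊗ iV (f_ j)
   - iV (f_ i) ⊗ iA (T (e j)) ⊗ iV (dual_rep rho (T (e i)) (f_ j))
   + iV (f_ i) ⊗ iA (br (T (e i)) (T (e j))) ⊗ iV (f_ j)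
   + iV (f_ i) ⊗ iV (f_ j) ⊗ iA (br (T (e i)) (T (e j)))
   - iV (f_ i) ⊗ iV (dual_rep rho (T (e i)) (f_ j)) ⊗ iA (T (e j)))).
  apply: eq_bigr => i _; rewrite /r !tlift_hom; try by solve_bilinear.
  rewrite -sumrN -big_split; apply: eq_bigr => j _ /=.
  rewrite !semidirect_AA !semidirect_AV // !semidirect_VA // !semidirect_VV //.
  rewrite !(bilinear_map0l tB) !(bilinear_map0r tB) !(bilinear_map0r tB3) !(bilinear_map0l tB3).
  rewrite !(addr0, add0r, subr0, sub0r).
  by zmod_cancel.
rewrite -[RHS]/(dsum _) !dsumD !dsumN.
have U1 : dsum (fun i j => iA (T (e i)) ⊗ iV (dual_rep rho (T (e j)) (f_ i)) ⊗ iV (f_ j))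
  = dsum (fun i j => iA (T (rho (T (e j)) (e i))) ⊗ iV (f_ i) ⊗ iV (f_ j)).
  rewrite dsumX (dsumT (fun u a v => iA a ⊗ iV v ⊗ iV u)); last by move=> u; solve_bilinear.
  exact: dsumX.
have U2 : dsum (fun i j => iV (dual_rep rho (T (e i)) (f_ j)) ⊗ iV (f_ i) ⊗ iA (T (e j)))
  = dsum (fun i j => iV (f_ i) ⊗ iV (f_ j) ⊗ iA (T (rho (T (e j)) (e i)))).
  rewrite (dsumT (fun u a v => iV v ⊗ iV u ⊗ iA a)); last by move=> u; solve_bilinear.
  exact: dsumX.
have U3 : dsum (fun i j => iA (T (e i)) ⊗ iV (f_ j) ⊗ iV (dual_rep rho (T (e j)) (f_ i)))
  = dsum (fun i j => iA (T (rho (T (e i)) (e j))) ⊗ iV (f_ i) ⊗ iV (f_ j)).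
  by rewrite dsumX (dsumT (fun u a v => iA a ⊗ iV u ⊗ iV v)) //; move=> u; solve_bilinear.
have U4 : dsum (fun i j => iV (dual_rep rho (T (e j)) (f_ i)) ⊗ iA (T (e i)) ⊗ iV (f_ j))
  = dsum (fun i j => iV (f_ i) ⊗ iA (T (rho (T (e j)) (e i))) ⊗ iV (f_ j)).
  rewrite dsumX (dsumT (fun u a v => iV v ⊗ iA a ⊗ iV u)); last by move=> u; solve_bilinear.
  exact: dsumX.
have U5 : dsum (fun i j => iV (f_ i) ⊗ iA (T (e j)) ⊗ iV (dual_rep rho (T (e i)) (f_ j)))
  = dsum (fun i j => iV (f_ i) ⊗ iA (T (rho (T (e i)) (e j))) ⊗ iV (f_ j)).
  by rewrite (dsumT (fun u a v => iV u ⊗ iA a ⊗ iV v)) //; move=> u; solve_bilinear.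
have U6 : dsum (fun i j => iV (f_ i) ⊗ iV (dual_rep rho (T (e i)) (f_ j)) ⊗ iA (T (e j)))
  = dsum (fun i j => iV (f_ i) ⊗ iV (f_ j) ⊗ iA (T (rho (T (e i)) (e j)))).
  by rewrite (dsumT (fun u a v => iV u ⊗ iV v ⊗ iA a)) //; move=> u; solve_bilinear.
rewrite U1 U2 U3 U4 U5 U6 -!dsumN -!dsumD.
apply: eq_bigr => i _; apply: eq_bigr => j _.
have iAL := @inA_linear K A D; have TL : linear T by exact: linearP.
rewrite /O_defect (linD TL) opprD !(linD iAL, linN iAL).
rewrite !(linD (tl _), linN (tl _), linD (tr _), linN (tr _),
  linD (tl3 _), linN (tl3 _), linD (tr3 _), linN (tr3 _)).
by zmod_cancel.
Qed.

(** Each of the three families of tensors in [mlyb_hom] has its A-component in a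
    different leg, so a functional that reads the A-component of the first leg
    sees only one of them. *)
Lemma mlyb_homP :
  mlyb brG r = 0 <-> forall u v, br (T u) (T v) = T (rho (T u) v + rho (T v) u).
Proof.
have tB := @tens_bilinear K G G; have tB3 := @tens_bilinear K G (G ⊗ G)%type.
rewrite mlyb_hom; split=> [E u v|H]; last first.
  rewrite big1 // => i _; rewrite big1 // => j _; rewrite /O_defect H subrr linear0.
  by rewrite (bilinear_map0l tB) (bilinear_map0r tB) (bilinear_map0l tB3) !(bilinear_map0r tB3) !addr0.
apply: subr0_eq; rewrite -/(O_defect u v).
pose F (x y w : G) : A := (y.2 u : K) *: ((w.2 v : K) *: x.1).
have FT : trilinear_map F.
  have evL (c : V) : linear (fun y : G => y.2 c : K^o).
    by move=> k y y'; rewrite /= add_lfunE scale_lfunE.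
  split=> [y w|x w|x y]; rewrite /F.
  - by do 2!apply: linear_scaler.
  - exact: linear_scalel.
  - by apply/linear_scaler/linear_scalel.
have FL := tlift3_linear FT.
have := congr1 (tlift3 F) E; rewrite (lin0 FL) (lin_sum _ _ FL).
under eq_bigr => i _.
  rewrite (lin_sum _ _ FL).
  under eq_bigr do rewrite !(linD FL) !tlift3_tens // /F /= !zero_lfunE !scale0r !scaler0 !addr0.
  rewrite -scaler_sumr (sum_dual_vbasis (L := O_defect (e i))); last by case: O_defect_bilinear.
  over.
by rewrite (sum_dual_vbasis (L := O_defect^~ v)) //; case: O_defect_bilinear.
Qed.

End YangBaxterHom.

Theorem theorem4p30 (K : fieldType) (A : lmodType K) (br : A -> A -> A)
    (N : A -> A) (V : vectType K) (rho : A -> 'End(V)) (beta : 'End(V))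
    (S : {linear A -> A}) (alpha : 'End(V)) (T : {linear V -> A}) :
  [pchar K] =i pred0 ->
  nijenhuis_mock_lie br N ->
  ml_rep br rho ->
  nml_rep br N (dual_rep rho) (transpose beta) ->
  let brG := semidirect br (dual_rep rho) in
  let M := sum_op N (transpose beta) in
  let Q := sum_op S (transpose alpha) in
  let r := hom_tensor_sd T - tflip (hom_tensor_sd T) in
  ((antisymmetric_tensor r /\ admissible_mlYBE brG M Q r) <->
   (weak_O_operator br N rho alpha T /\ forall v, T (beta v) = S (T v)))
  /\
  (nml_rep br N rho alpha ->
   O_operator br N rho alpha T ->
   (forall v, T (beta v) = S (T v)) ->
   (antisymmetric_tensor r /\ admissible_mlYBE brG M Q r) /\
   (adjoint_admissible br N S ->
    (forall y u,
       beta (rho y (alpha u)) + rho (S (S y)) u =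
       rho (S y) (alpha u) + beta (rho (S y) u)) ->
    nijenhuis_mock_lie_bialgebra brG M (coboundary brG r) Q)).
Proof.
move=> _ brN rhoR dualR brG M Q r.
have brB := ml_bilinear (nml_mock_lie brN); have rhoL := mlr_linear rhoR.
have GN : nijenhuis_mock_lie brG M := semidirect_nijenhuis brN dualR.
have [N' NE] := linear_pack (nml_linear brN).
rewrite {}/M in GN *; subst N; rewrite -/(sum_op N' (transpose beta)).
set M := sum_op N' _ in GN *.
have rA : antisymmetric_tensor r := antisymmetric_sub_tflip _.
have YBP := mlyb_homP T brB rhoL; rewrite -/brG -/r in YBP.
have MQP := intertwine_homP N' S alpha beta T; rewrite -/r in MQP.
have QMP := intertwine_homP S N' beta alpha T; rewrite -/r in QMP.
have main : (antisymmetric_tensor r /\ admissible_mlYBE brG M Q r) <->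
   (weak_O_operator br N' rho alpha T /\ forall v, T (beta v) = S (T v)).
  split=> [[_ [/YBP YB /MQP[NT ST] _]]|[[/YBP YB NT] ST]]; first by split.
  by split=> //; split; [exact: YB | apply/MQP; split | apply/QMP; split].
split=> // alphaR [_ TO] ST.
have [_ [YB MQ QM]] := main.2 (conj TO ST).
split=> // SA rhoS.
apply: coboundary_nijenhuis_bialgebra => //.
- exact: nml_mock_lie GN.
- exact: semidirect_adjoint_admissible.
Qed.
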